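(* Let $X$ be a compact metric space with metric $d$. If a continuous map $f\colon X\to X$ is h-expansive and has the shadowing property, then every non-empty uniformly rigid subset $S$ of $X$ is zero-dimensional.
   Context: Let $X$ be a compact metric space with metric $d$ and let $f\colon X\to X$ be a continuous map. Shadowing: for $\delta>0$, a sequence $(x_i)_{i\ge0}$ of points of $X$ is a $\delta$-pseudo orbit of $f$ if $d(f(x_i),x_{i+1})\le\delta$ for all $i\ge0$. For $\epsilon>0$, it is $\epsilon$-shadowed by $x\in X$ if $d(f^i(x),x_i)\le\epsilon$ for all $i\ge0$. The map $f$ has the shadowing property if for any $\epsilon>0$ there is $\delta>0$ such that every $\delta$-pseudo orbit of $f$ is $\epsilon$-shadowed by some point of $X$. h-expansiveness: for $K\subset X$, $n\ge1$ and $r>0$, a subset $E\subset K$ is $(n,r)$-separated if $\max_{0\le i\le n-1}d(f^i(x),f^i(y))>r$ for all $x,y\in E$ with $x\ne y$. Let $s_n(f,K,r)$ be the largest cardinality of an $(n,r)$-separated subset of $K$, let $h(f,K,r)=\limsup_{n\to\infty}\frac1n\log s_n(f,K,r)$, and let $h(f,K)=\lim_{r\to0}h(f,K,r)$. For $x\in X$ and $\epsilon>0$ let $\Phi_\epsilon(x)=\{y\in X\colon d(f^i(x),f^i(y))\le\epsilon\text{ for all }i\ge0\}$, and let $h_f^\ast(\epsilon)=\sup_{x\in X}h(f,\Phi_\epsilon(x))$. The map $f$ is h-expansive if $h_f^\ast(\epsilon)=0$ for some $\epsilon>0$. Uniform rigidity: a subset $S$ of $X$ is uniformly rigid (with respect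 to $f$) if for any $\gamma>0$ there is an integer $l>0$ such that $\sup_{x\in S}d(x,f^l(x))\le\gamma$. Zero-dimensionality: a subset $S$ of $X$ is zero-dimensional if it is non-empty and for any $x\in S$ and any open subset $U$ of $S$ (in the subspace topology) with $x\in U$, there is a clopen subset $V$ of $S$ such that $x\in V\subset U$. *)

(* Defs.v *)
From HB Require Import structures.
From mathcomp Require Import all_boot all_order all_algebra finmap.
From mathcomp Require Import all_classical all_reals all_analysis.

Set Implicit Arguments.
Unset Strict Implicit.
Unset Printing Implicit Defensive.

Import Order.TTheory GRing.Theory Num.Theory.
Import numFieldNormedType.Exports.

Local Open Scope classical_set_scope.
Local Open Scope ring_scope.

Section Dynamics.
Context {R : realType} {X : metricType R}.
Implicit Types (f : X -> X) (K S : set X) (x y : X).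

Definition pseudo_orbit f (delta : R) (u : nat -> X) : Prop :=
  forall i, mdist (f (u i)) (u i.+1) <= delta.

Definition shadowed_by f (eps : R) (u : nat -> X) x : Prop :=
  forall i, mdist (iter i f x) (u i) <= eps.

Definition shadowing_property f : Prop :=
  forall eps : R, 0 < eps -> exists2 delta : R, 0 < delta &
    forall u, pseudo_orbit f delta u -> exists x, shadowed_by f eps u x.

(* The default value 0 is neutral, since distances are nonnegative. *)
Definition orbit_dist f (n : nat) x y : R :=
  \big[Num.max/0]_(i < n) mdist (iter i f x) (iter i f y).

Definition separated f (n : nat) (r : R) (E : set X) : Prop :=
  forall x y, E x -> E y -> x <> y -> r < orbit_dist f n x y.

(* Extended-real valued, as the maximum is known to exist only when X is
   compact and f is continuous. *)
Definition sep_card f K (n : nat) (r : R) : \bar R :=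
  ereal_sup [set (#|` E|%:R)%:E | E in
    [set E : {fset X} | [set` E] `<=` K /\ separated f n r [set` E]]].

(* The term of index 0 of the sequence is irrelevant to the limsup. *)
Definition entropy_at f K (r : R) : \bar R :=
  limn_esup (fun n => ((n%:R^-1)%:E * lne (sep_card f K n r))%E).

Definition entropy f K : \bar R := lim (entropy_at f K r @[r --> 0^'+]).

Definition Phi f (eps : R) x : set X :=
  [set y | forall i, mdist (iter i f x) (iter i f y) <= eps].

Definition hstar f (eps : R) : \bar R :=
  ereal_sup [set entropy f (Phi f eps x) | x in [set: X]].

Definition h_expansive f : Prop :=
  exists2 eps : R, 0 < eps & hstar f eps = 0%E.

Definition uniformly_rigid f S : Prop :=
  forall gamma : R, 0 < gamma -> exists2 l : nat, (0 < l)%N &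
    (ereal_sup [set (mdist x (iter l f x))%:E | x in S] <= gamma%:E)%E.

End Dynamics.

(* The library's [zero_dimensional] only asks that distinct points be separated
   by a clopen set, which is weaker than having a clopen basis. *)
Definition zero_dim_space (T : topologicalType) : Prop :=
  [set: T] !=set0 /\
  forall (x : T) (U : set T), open U -> U x ->
    exists V : set T, [/\ clopen V, V x & V `<=` U].

(* [set_type S] carries the topology induced by the inclusion into X. *)
Definition zero_dim_subset (X : topologicalType) (S : set X) : Prop :=
  zero_dim_space (set_type S).

(* Main.v *)
(** If S were not zero-dimensional at x, arbitrarily fine chains in S starting
    at x would leave a fixed ball around x.  Pick l such that f^l is close to the
    identity on S, and cut such a chain z_0, z_1, ... at the first index m where
    the l-orbits of z_0 and z_m are e/2 apart at some time j < l; up to m, all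
    l-orbits stay e-close to that of z_0.  Since f^l returns close to the identity,
    staying at z_0 for 2ml steps and travelling to z_m and back in 2ml steps are
    two pseudo-orbit loops which can be concatenated freely.  Shadowing all
    binary words yields 2^q separated points at time 2mlq in a single set
    Phi_eps(p), whose entropy is then positive, against h-expansiveness. *)

Require Import Defs.
From HB Require Import structures.
From mathcomp Require Import all_boot all_order all_algebra finmap.
From mathcomp Require Import all_classical all_reals all_analysis.
From mathcomp Require Import zify ring lra.
Import Order.TTheory GRing.Theory Num.Theory.
Import numFieldNormedType.Exports.
Local Open Scope classical_set_scope.
Local Open Scope ring_scope.

(** * Entropy: monotonicity and a lower bound from binary coding *)

Section Entropy.
Context {R : realType} {X : metricType R}.
Implicit Types (f : X -> X) (K : set X) (x y : X).

Lemma le_limn_esup (u v : (\bar R)^nat) :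
  (forall n, u n <= v n)%E -> (limn_esup u <= limn_esup v)%E.
Proof.
move=> uv; apply/ereal_infP => _ [V V_oo <-].
apply: (@le_trans _ _ (ereal_sup [set u n | n in V])).
  by apply: ereal_inf_lbound; exists V.
apply/ereal_supP => _ [n Vn <-]; apply: (le_trans (uv n)).
by apply: ereal_sup_ubound; exists n.
Qed.

Lemma limn_esup_ge_frequently (u : (\bar R)^nat) c :
  (forall N, exists2 n, (N <= n)%N & c <= u n)%E -> (c <= limn_esup u)%E.
Proof.
move=> cu; apply/ereal_infP => _ [V [N _ NV] <-].
have [n Nn cun] := cu N; apply: (le_trans cun).
by apply: ereal_sup_ubound; exists n => //; exact: NV.
Qed.

Lemma sep_card_ge0 f K n (r : R) : (0 <= sep_card f K n r)%E.
Proof.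
apply: ereal_sup_ubound; exists fset0; last by rewrite cardfs0.
by split=> [x|x y] /=; rewrite inE.
Qed.

Lemma le_sep_card f K K' n (r r' : R) : K `<=` K' -> r <= r' ->
  (sep_card f K n r' <= sep_card f K' n r)%E.
Proof.
move=> KK' rr'; apply: le_ereal_sup => _ [E [EK Esep] <-].
exists E => //; split=> [|x y Ex Ey xy]; first exact: subset_trans KK'.
by apply: (le_lt_trans rr'); exact: Esep.
Qed.

Lemma le_entropy_at f K K' (r r' : R) : K `<=` K' -> r <= r' ->
  (entropy_at f K r' <= entropy_at f K' r)%E.
Proof.
move=> KK' rr'; apply: le_limn_esup => n.
apply: lee_wpmul2l; first by rewrite lee_fin invr_ge0.
by rewrite lee_lne ?in_itv /= ?leey ?andbT ?sep_card_ge0// le_sep_card.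
Qed.

(** [entropy_at f K] is nonincreasing in the scale, so its limit at [0^'+] exists and dominates
    every value. *)
Lemma entropy_at_le_entropy f K (r : R) :
  0 < r -> (entropy_at f K r <= entropy f K)%E.
Proof.
move=> r0; apply: lime_ge.
  apply: nonincreasing_at_right_is_cvge; apply: nearW => t x y _ _.
  exact: le_entropy_at.
near=> s; apply: le_entropy_at => //; near: s.
exact: nbhs_right_le.
Unshelve. all: by end_near. Qed.

Lemma orbit_dist_ge f n x y i : (i < n)%N ->
  mdist (iter i f x) (iter i f y) <= orbit_dist f n x y.
Proof.
move=> ni; rewrite /orbit_dist.
exact: (le_bigmax 0 (fun i : 'I_n => mdist (iter i f x) (iter i f y)) (Ordinal ni)).
Qed.

(** Words of length m, padded with [false], code 2^m points separated by time mT. This bounds the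
    growth only at multiples of T, which is enough for a limsup. *)
Lemma entropy_at_ge_ln2 f K (r : R) (T : nat) (p : (nat -> bool) -> X) :
  0 <= r -> (0 < T)%N -> (forall b, K (p b)) ->
  (forall b b' q, b q != b' q -> exists2 i, (i < T)%N &
     r < mdist (iter (q * T + i) f (p b)) (iter (q * T + i) f (p b'))) ->
  ((ln 2 / T%:R)%:E <= entropy_at f K r)%E.
Proof.
move=> r0 T0 pK psep; apply: limn_esup_ge_frequently => N.
set m := N.+1; exists (m * T)%N; first by rewrite /m; nia.
have wsep (w w' : m.-tuple bool) : w != w' ->
    r < orbit_dist f (m * T) (p (nth false w)) (p (nth false w')).
  move=> ww'; have [q qm wq] :
      exists2 q, (q < m)%N & nth false w q != nth false w' q.
    apply/not_exists2P => H; move/eqP: ww'; apply; apply: val_inj.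
    apply: (@eq_from_nth _ false); rewrite !size_tuple// => q qm.
    by have [] := H q => // /negP/negPn/eqP.
  have [i iT ri] := psep _ _ q wq.
  by apply: (lt_le_trans ri); apply: orbit_dist_ge; nia.
pose E := [fset p (nth false w) | w : m.-tuple bool in {: m.-tuple bool}]%fset.
have cardE : #|` E| = (2 ^ m)%N.
  rewrite card_imfset /=; first by rewrite -cardE card_tuple card_bool.
  (* The coding is injective: a point is at orbit distance 0 from itself, and 0 does not exceed
     r. *)
  move=> w w' pww'; apply/eqP/negPn/negP => /wsep.
  rewrite pww' ltNge => /negP; apply; apply: bigmax_le => // i _.
  by rewrite mdistxx.
have sepE : ((2 ^+ m : R)%R%:E <= sep_card f K (m * T) r)%E.
  rewrite -natrX -cardE; apply: ereal_sup_ubound; exists E => //; split.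
    by move=> _ /imfsetP[w _ ->].
  move=> _ _ /imfsetP[w _ ->] /imfsetP[w' _ ->] pww'.
  by apply: wsep; apply/eqP => ww'; apply: pww'; rewrite ww'.
have -> : (ln 2 / T%:R)%:E = (((m * T)%:R^-1)%:E * lne (2 ^+ m : R)%R%:E)%E.
  rewrite lne_EFin ?exprn_gt0// -EFinM lnXn//; congr EFin.
  by rewrite natrM -mulr_natl; field; rewrite !pnatr_eq0; lia.
apply: lee_wpmul2l; first by rewrite lee_fin invr_ge0.
by rewrite lee_lne ?in_itv /= ?leey ?andbT ?sep_card_ge0// lee_fin exprn_ge0.
Qed.

End Entropy.

(** * Shadowing of loops, and chains in a rigid set *)

Section ChainLoops.
Context {R : realType} {X : metricType R}.
Implicit Types (f : X -> X) (S : set X) (x y : X).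

Lemma metric_triangle_le x y z (a b c : R) :
  mdist x y <= a -> mdist y z <= b -> a + b <= c -> mdist x z <= c.
Proof.
move=> xy yz abc; apply: le_trans abc.
by apply: le_trans (metric_triangle x y z) _; exact: lerD.
Qed.

Lemma compact_iter_equicontinuous f (l : nat) (e : R) :
  compact [set: X] -> continuous f -> 0 < e ->
  \forall d \near 0^'+, forall x y, mdist x y <= d ->
    forall i, (i < l)%N -> mdist (iter i f x) (iter i f y) <= e.
Proof.
move=> cX cf e0.
have unif i : \forall d \near (0 : R)^'+, forall x y, mdist x y <= d ->
    mdist (iter i f x) (iter i f y) <= e.
  have cfi : continuous (iter i f).
    elim: i => [|i IH] x; first exact: cvg_id.
    by apply: (@continuous_comp _ _ _ (iter i f) f); [exact: IH|exact: cf].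
  have /compact_near_coveringP cov := cX.
  suff : \forall d \near (0 : R)^'+, [set: X] `<=`
      [set x | forall y, mdist x y <= d -> mdist (iter i f x) (iter i f y) <= e].
    by apply: filterS => d H x y; exact: H.
  apply: cov => x _.
  have : \forall y \near x, mdist (iter i f x) (iter i f y) < e / 2.
    apply: (@metricType_numDomainType.cvgr_dist_lt _ _ _ _ _ _ _ (cfi x)).
    by rewrite divr_gt0.
  move=> /nbhs_ballP[a /= a0 xa].
  (* Half of the radius a is for moving the centre to [x'], the other half for the distance from
     [x'] to [y]. *)
  exists (ball x (a / 2), [set d | d < a / 2]) => /=.
    split; first by apply: nbhsx_ballx; rewrite divr_gt0.
    by apply: nbhs_right_lt; rewrite divr_gt0.
  move=> [x' d] /= [xx' da] y x'y.
  have a2 : a = a / 2 + a / 2 by field.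
  have x'y' : ball x' (a / 2) y.
    by rewrite ballEmdist /=; exact: le_lt_trans da.
  have h1 : mdist (iter i f x) (iter i f x') < e / 2.
    by apply: xa; apply: le_ball xx'; lra.
  have h2 : mdist (iter i f x) (iter i f y) < e / 2.
    by apply: xa; rewrite a2; exact: ball_triangle x'y'.
  rewrite metric_sym in h1.
  by apply: (metric_triangle_le _ _ _ _ _ _ (ltW h1) (ltW h2)); lra.
have : \forall d \near (0 : R)^'+, forall i : 'I_l, forall x y,
    mdist x y <= d -> mdist (iter i f x) (iter i f y) <= e.
  by apply: filter_forall => i; exact: unif.
by apply: filterS => d H x y xy i il; exact: (H (Ordinal il)).
Qed.

(** The successor of n = qT + i lies in block q, or starts block q + 1 when i = T - 1. *)
Lemma pseudo_orbit_blocks f (delta : R) (T : nat) (B : nat -> nat -> X) :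
  (0 < T)%N ->
  (forall q i, (i.+1 < T)%N -> mdist (f (B q i)) (B q i.+1) <= delta) ->
  (forall q, mdist (f (B q T.-1)) (B q.+1 0) <= delta) ->
  pseudo_orbit f delta (fun n => B (n %/ T)%N (n %% T)%N).
Proof.
move=> T0 Bin Bout n; have := ltn_pmod n T0; rewrite leq_eqVlt => /predU1P[nT|nT].
  have -> : (n.+1 %% T)%N = 0%N by rewrite -addn1 -modnDml addn1 nT modnn.
  have -> : (n.+1 %/ T)%N = (n %/ T).+1.
    by rewrite {1}(divn_eq n T) -addnS nT divnMDl// divnn T0 addn1.
  by move/(congr1 predn): nT => /= ->.
have -> : (n.+1 %% T = (n %% T).+1)%N by rewrite -addn1 -modnDml addn1 modn_small.
have -> : (n.+1 %/ T = n %/ T)%N.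
  by rewrite {1}(divn_eq n T) -addnS divnMDl// (divn_small nT) addn0.
exact: Bin.
Qed.

(** Two pseudo-orbit loops based at [a] can follow each other in any order, so each binary sequence
    has a shadowing point. Passing from loops to shadowing points costs [eps1] at both ends, which
    widens [eps] and narrows the gap by [2 * eps1]. *)
Lemma horseshoe f (T : nat) (A : bool -> nat -> X) (a : X) (delta eps1 eps r : R) :
  (0 < T)%N -> 0 <= r ->
  (forall u, pseudo_orbit f delta u -> exists x, shadowed_by f eps1 u x) ->
  (forall c i, mdist (f (A c i)) (A c i.+1) <= delta) ->
  (forall c, A c 0 = a) -> (forall c, A c T = a) ->
  (forall i, mdist (A false i) (A true i) <= eps) ->
  (exists2 i, (i < T)%N & r + 2 * eps1 < mdist (A false i) (A true i)) ->
  exists x, ((ln 2 / T%:R)%:E <= entropy_at f (Phi f (eps + 2 * eps1) x) r)%E.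
Proof.
move=> T0 r0 sh Ad A0 AT Aeps [i iT Ar].
have ps b : pseudo_orbit f delta (fun n => A (b (n %/ T)%N) (n %% T)%N).
  apply: (pseudo_orbit_blocks f delta T (fun q => A (b q))) => // q.
  by have := Ad (b q) T.-1; rewrite prednK// AT A0.
have /choice[p pb] b := sh _ (ps b).
(* The centre shadows the loop [A false] repeated forever, from which every other concatenation
   stays within [eps]. *)
exists (p (fun=> false)); apply: (@entropy_at_ge_ln2 _ _ _ _ _ _ p) => //.
  move=> b n; have := pb b n; have := pb (fun=> false) n => /=.
  set c := b _; set j := (n %% T)%N; rewrite /= => h0 h1.
  have e0 : 0 <= eps by apply: le_trans (Aeps 0); exact: mdist_ge0.
  have h2 : mdist (A false j) (A c j) <= eps by case: c {h1} => //; rewrite mdistxx.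
  apply: (metric_triangle_le _ _ _ _ (eps + eps1) _ h0); last by lra.
  by apply: (metric_triangle_le _ _ _ _ _ _ h2 _ (lexx _)); rewrite metric_sym.
move=> b b' q; wlog bq : b b' / b q = false => [wl bb'|].
  case bq : (b q); last exact: wl.
  have b'q : b' q = false by move: bb'; rewrite bq; case: (b' q).
  have [|j jT rj] := wl b' b b'q; first by rewrite eq_sym.
  by exists j => //; rewrite metric_sym.
rewrite bq => b'q; have {}b'q : b' q = true by case: (b' q) b'q.
exists i => //; have := pb b (q * T + i)%N; have := pb b' (q * T + i)%N => /=.
rewrite divnMDl// divn_small// addn0 modnMDl modn_small// bq b'q => h1 h0.
rewrite ltNge; apply/negP => h; move: Ar; apply/negP; rewrite -leNgt.
have h2 := metric_triangle_le _ _ _ _ _ _ h h1 (lexx _).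
rewrite metric_sym in h0.
by apply: (metric_triangle_le _ _ _ _ _ _ h0 h2); lra.
Qed.

(** The gap e/2 between the loops is split as e/4 for the separation scale plus two shadowing errors
    e/8. *)
Lemma escaping_chain_entropy f S (l : nat) (z : nat -> X) (e delta : R) :
  0 < e -> (0 < l)%N ->
  (forall u, pseudo_orbit f delta u -> exists x, shadowed_by f (e / 8) u x) ->
  (forall x, S x -> mdist x (iter l f x) <= delta / 2) ->
  (forall i, S (z i)) ->
  (forall i, mdist (z i) (z i.+1) <= delta / 2) ->
  (forall i j, (j < l)%N ->
     mdist (iter j f (z i)) (iter j f (z i.+1)) <= e / 2) ->
  (exists k, e / 2 < mdist (z 0) (z k)) ->
  exists x, exists2 T, (0 < T)%N &
    ((ln 2 / T%:R)%:E <= entropy_at f (Phi f (e + 2 * (e / 8)) x) (e / 4))%E.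
Proof.
move=> e0 l0 sh rigid zS zd ze [k zk].
pose P n := [exists j : 'I_l, e / 2 < mdist (iter j f (z 0)) (iter j f (z n))].
have exP : exists n, P n by exists k; apply/existsP; exists (Ordinal l0).
case: (ex_minnP exP) => m /existsP[j0 zm] mmin {exP k zk}.
have m0 : (0 < m)%N.
  by rewrite lt0n; apply/eqP => mE; move: zm; rewrite mE mdistxx; lra.
have z_before n j : (n < m)%N -> (j < l)%N ->
    mdist (iter j f (z 0)) (iter j f (z n)) <= e / 2.
  move=> nm jl; rewrite leNgt; apply/negP => h.
  by have := mmin n; rewrite leqNgt nm => /(_ _)/negP; apply => //;
     apply/existsP; exists (Ordinal jl).
have z_upto n j : (n <= m)%N -> (j < l)%N ->
    mdist (iter j f (z 0)) (iter j f (z n)) <= e.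
  (* Index m itself is reached from m - 1, within e/2 of the start, by one more step of size e/2. *)
  rewrite leq_eqVlt => /predU1P[->|nm] jl; last by have := z_before n j nm jl; lra.
  have m1 : (m.-1 < m)%N by rewrite prednK.
  have := ze m.-1 _ jl; rewrite prednK// => h.
  by apply: (metric_triangle_le _ _ _ _ _ _ (z_before _ _ m1 jl) h); lra.
(* truncated subtraction keeps w true q at z 0 for q >= 2 * m *)
pose w (c : bool) q := if c then z (minn q (2 * m - q)) else z 0.
have wS c q : S (w c q) by case: c; exact: zS.
have wd c q : mdist (w c q) (w c q.+1) <= delta / 2.
  have d0 : 0 <= delta / 2 by apply: le_trans (zd 0%N); exact: mdist_ge0.
  case: c => /=; last by rewrite mdistxx.
  have [qm|mq] := ltnP q m.
    have -> : minn q (2 * m - q) = q by lia.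
    by have -> : minn q.+1 (2 * m - q.+1) = q.+1 by lia.
  have [qm|mq2] := ltnP q (2 * m).
    have -> : minn q (2 * m - q) = (minn q.+1 (2 * m - q.+1)).+1 by lia.
    by rewrite metric_sym.
  have -> : minn q (2 * m - q) = 0%N by lia.
  have -> : minn q.+1 (2 * m - q.+1) = 0%N by lia.
  by rewrite mdistxx.
have [||c|c|c|n||x xP] := horseshoe f (2 * m * l)
    (fun c n => iter (n %% l) f (w c (n %/ l)%N)) (z 0) delta (e / 8) e (e / 4)
    _ _ sh.
- by rewrite !muln_gt0 m0 l0.
- by lra.
(* Segments of length l are true orbits; at their ends, the rigid return and the next chain step
   cost [delta / 2] each. *)
- apply: (pseudo_orbit_blocks f delta l (fun q i => iter i f (w c q))) => // q.
    move=> i _; rewrite mdistxx.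
    by have := le_trans (mdist_ge0 _ _) (zd 0%N); lra.
  rewrite -iterS prednK//=.
  have := rigid _ (wS c q); rewrite metric_sym => h.
  by apply: (metric_triangle_le _ _ _ _ _ _ h (wd c q)); lra.
- by rewrite mod0n div0n /=; case: c => //=; rewrite min0n.
- rewrite modnMl mulnK//= /w; case: c => //.
  by have -> : minn (2 * m) (2 * m - 2 * m) = 0%N by lia.
- by apply: z_upto; [lia|rewrite ltn_pmod].
(* Segment m is the turning point of the loop, where it follows the orbit of [z m]. *)
- exists (m * l + j0)%N; first by have := ltn_ord j0; nia.
  rewrite modnMDl modn_small// divnMDl// divn_small// addn0 /=.
  have -> : minn m (2 * m - m) = m by lia.
  by apply: le_lt_trans zm; lra.
- by exists x, (2 * m * l)%N => //; rewrite !muln_gt0 m0 l0.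
Qed.

(** Finite chains are encoded as infinite ones passing through y, the form in which
    [escaping_chain_entropy] takes them. *)
Definition chain_component S (g : R) x : set X :=
  [set y | exists z : nat -> X, [/\ z 0 = x, forall i, S (z i),
     forall i, mdist (z i) (z i.+1) <= g & exists k, z k = y]].

Lemma chain_component_step S (g : R) x y y' : 0 <= g ->
  chain_component S g x y -> S y' -> mdist y y' <= g -> chain_component S g x y'.
Proof.
move=> g0 [z [z0 zS zg [k zk]]] Sy' yy'.
exists (fun i => if (i <= k)%N then z i else y'); split=> //.
- by move=> i; case: ifP.
- move=> i; case: (ltngtP i k) => ik; first exact: zg.
    by rewrite mdistxx.
  by rewrite ik zk.
- by exists k.+1; rewrite ltnn.
Qed.

(** A move of size at most g within S neither enters nor leaves the component, so it and its
    complement are both open in S. *)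
Lemma clopen_chain_component S (g : R) x : 0 < g ->
  clopen (set_val @^-1` chain_component S g x : set (set_type S)).
Proof.
move=> g0; have near_close (y : set_type S) :
    \forall y' \near y, mdist (set_val y) (set_val y') <= g.
  have c : {for y, continuous (@set_val X S)} by exact: initial_continuous.
  exact: (@metricType_numDomainType.cvgr_dist_le _ _ _ _ _ _ _ c).
split.
  rewrite openE => y /= Vy; apply: filterS (near_close y) => y' /=.
  by apply: chain_component_step Vy _ => //; [exact: ltW|exact: set_valP].
rewrite -openC openE => y /= nVy; apply: filterS (near_close y) => y' /= yy' Vy'.
apply: nVy; apply: chain_component_step Vy' _ _ => //; first exact: ltW.
  exact: set_valP.
by rewrite metric_sym.
Qed.

End ChainLoops.

(** * Chain components as small clopen neighbourhoods *)

Theorem theorem1p1 (R : realType) (X : metricType R) (f : X -> X) :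
  compact [set: X] ->
  continuous f ->
  h_expansive f ->
  shadowing_property f ->
  forall S : set X, S !=set0 -> uniformly_rigid f S -> zero_dim_subset S.
Proof.
move=> cX cf [eps0 eps00 hexp] shadow S [s Ss] rigid; split.
  by exists (SigSub (mem_set Ss)).
move=> x U oU Ux.
have [rho rho0 rhoU] : exists2 rho : R, 0 < rho &
    forall y : set_type S, mdist (set_val x) (set_val y) < rho -> U y.
  move: oU => [B oB BU]; have Bx : B (set_val x) by rewrite -BU in Ux.
  have /nbhs_ballP[rho /= rho0 rhoB] := open_nbhs_nbhs (conj oB Bx).
  by exists rho => // y xy; rewrite -BU; apply: rhoB; rewrite ballEmdist.
(* Then leaving the [rho]-ball gives a gap above e/2, and the radius e + 2(e/8) = 5e/4 stays below
   [eps0]. *)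
pose e := Num.min rho eps0 / 2.
have e0 : 0 < e by rewrite divr_gt0// lt_min rho0.
have e_rho : e / 2 < rho.
  have : Num.min rho eps0 <= rho by rewrite ge_min lexx.
  by move: e0; rewrite /e; lra.
have e_eps0 : e + 2 * (e / 8) <= eps0.
  have : Num.min rho eps0 <= eps0 by rewrite ge_min lexx orbT.
  by move: e0; rewrite /e; lra.
have e8 : 0 < e / 8 by rewrite divr_gt0.
have [delta delta0 sh] := shadow _ e8.
have delta20 : 0 < delta / 2 by rewrite divr_gt0.
have [l l0 /ereal_supP rigid_l] := rigid _ delta20.
have [g /= [g0 gdelta ge]] : exists g : R, [/\ 0 < g, g <= delta / 2 &
    forall x y, mdist x y <= g ->
    forall i, (i < l)%N -> mdist (iter i f x) (iter i f y) <= e / 2].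
  near (0 : R)^'+ => g; exists g; split => //.
    by near: g; exact: nbhs_right_le.
  by near: g; apply: compact_iter_equicontinuous => //; rewrite divr_gt0.
exists (set_val @^-1` chain_component S g (set_val x)); split.
- exact: clopen_chain_component.
- exists (fun=> set_val x); split=> [//|_|_|]; first exact: set_valP.
    by rewrite mdistxx ltW.
  by exists 0%N.
(* A chain reaching distance [rho] would force entropy at least ln 2 / T in some [Phi f eps0 p],
   contradicting [hexp]. *)
move=> y [z [z0 zS zg [k zk]]]; apply: rhoU; rewrite ltNge; apply/negP => far.
have [p [T T0 ent]] : exists p, exists2 T, (0 < T)%N &
    ((ln 2 / T%:R)%:E <= entropy_at f (Phi f (e + 2 * (e / 8)) p) (e / 4))%E.
  apply: (escaping_chain_entropy f S l z e delta) => //.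
  - by move=> t St; have := rigid_l _ (ex_intro2 _ _ t St erefl); rewrite lee_fin.
  - by move=> i; exact: le_trans (zg i) gdelta.
  - by move=> i; exact: ge.
  - by exists k; rewrite z0 zk; exact: lt_le_trans far.
have e40 : 0 < e / 4 by rewrite divr_gt0.
have : ((ln 2 / T%:R)%:E <= hstar f eps0)%E.
  apply: (le_trans ent).
  apply: (@le_trans _ _ (entropy_at f (Phi f eps0 p) (e / 4))).
    by apply: le_entropy_at => // t pt i; exact: le_trans (pt i) e_eps0.
  apply: (le_trans (entropy_at_le_entropy _ _ _ e40)).
  by apply: ereal_sup_ubound; exists p.
rewrite hexp lee_fin leNgt divr_gt0 ?ltr0n// ln_gt0//.
by rewrite ltr1n.
Unshelve. all: by end_near. Qed.
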